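(* For every $n\ge0$, with $Y:={}_2F_1\!\left(1,n+\tfrac12;n+1;-1\right)$, one has $$-i\,d_n=-\frac{16n^2+8n+3}{\sqrt2}\,\alpha_n\,q+\Big(8n^2+22n+6-(16n^2+8n+3)\,Y\Big)\alpha_n^2\,q^2+O(q^3).$$ In particular the coefficient $\delta_2$ of $q^2$ in $-i\,d_n$ is $\big(8n^2+22n+6-(16n^2+8n+3)Y\big)\alpha_n^2$.
   Context: For integers $k\ge0$ put $\alpha_k:=(-4)^{-k}\binom{2k}{k}$. Put $c_0(2k):=(-1)^k\frac{d^{2k}}{dx^{2k}}\big(e^{x}+e^{-x}\big)^{-1/2}\big|_{x=0}$ and $c_0(2k+1):=0$. As power series in $q$ define $c(2k)(q):=c_0(2k)+2(-1)^k\sum_{\ell\ge0}\alpha_\ell(\tfrac12+2\ell)^{2k}\frac{q^{2\ell+1}}{1-q^{2\ell+1}}$ and $c(2k+1)(q):=0$. For $n\ge0$ let $D_n(q)$ be the determinant of the Hankel matrix $(c(i+j)(q))_{0\le i,j\le n}$, and $D_{-1}:=1$. The Jacobi coefficients are $a(n)^2(q):=D_{n-1}(q)D_{n+1}(q)/D_n(q)^2$ for $n\ge0$, with $a(-1)^2:=0$, and $d_n$ is defined by $-i\,d_n:=-2n-\tfrac12+a(n)^2-a(n-1)^2$ (a power series in $q$). ${}_2F_1$ is the Gauss hypergeometric function (its series converges at $z=-1$ here). *)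

(* Defs.v *)
From HB Require Import structures.
From mathcomp Require Import all_boot all_order all_algebra.
From mathcomp Require Import all_classical all_reals all_analysis.
From mathcomp Require Import complex.

Set Implicit Arguments.
Unset Strict Implicit.
Unset Printing Implicit Defensive.

Import Order.TTheory GRing.Theory Num.Theory.
Import numFieldNormedType.Exports.

Local Open Scope ring_scope.

(* Formal power series in one variable q over a field K; f m is the
   coefficient of q^m. *)

Record fps (K : Type) := Fps { fps_coef :> nat -> K }.

Lemma fpsP (K : Type) (f g : fps K) : (forall m, f m = g m) -> f = g.
Proof. by case: f g => [f] [g] /= fg; congr Fps; apply: funext. Qed.

HB.instance Definition _ (K : Type) := gen_eqMixin (fps K).
HB.instance Definition _ (K : Type) := gen_choiceMixin (fps K).

Section FpsRing.
Variable K : fieldType.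
Implicit Types f g h : fps K.

Definition fps_zero : fps K := Fps (fun _ => 0).
Definition fps_opp f : fps K := Fps (fun m => - f m).
Definition fps_add f g : fps K := Fps (fun m => f m + g m).

Fact fps_addA : associative fps_add.
Proof. by move=> f g h; apply: fpsP => m /=; rewrite addrA. Qed.
Fact fps_addC : commutative fps_add.
Proof. by move=> f g; apply: fpsP => m /=; rewrite addrC. Qed.
Fact fps_add0 : left_id fps_zero fps_add.
Proof. by move=> f; apply: fpsP => m /=; rewrite add0r. Qed.
Fact fps_addN : left_inverse fps_zero fps_opp fps_add.
Proof. by move=> f; apply: fpsP => m /=; rewrite addNr. Qed.

HB.instance Definition _ :=
  GRing.isZmodule.Build (fps K) fps_addA fps_addC fps_add0 fps_addN.

Definition fps_const (c : K) : fps K := Fps (fun m => if m == 0%N then c else 0).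
Definition fps_one : fps K := fps_const 1.
Definition fps_mul f g : fps K :=
  Fps (fun m => \sum_(i < m.+1) f i * g (m - i)%N).

Definition fps_trunc n f : {poly K} := \poly_(i < n.+1) f i.

Fact fps_truncE n f i : (i <= n)%N -> (fps_trunc n f)`_i = f i.
Proof. by move=> lein; rewrite coef_poly ltnS lein. Qed.

Fact fps_mulE n f g i : (i <= n)%N ->
  fps_mul f g i = (fps_trunc n f * fps_trunc n g)`_i.
Proof.
move=> lein; rewrite coefM /=; apply: eq_bigr => j _.
rewrite !fps_truncE //; first by apply: leq_trans (leq_subr _ _) lein.
by apply: leq_trans lein; rewrite -ltnS.
Qed.

Fact fps_mulC : commutative fps_mul.
Proof.
by move=> f g; apply: fpsP => m; rewrite !(fps_mulE _ _ (leqnn m)) mulrC.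
Qed.

Fact fps_mulA : associative fps_mul.
Proof.
move=> f g h; apply: fpsP => m; rewrite !(fps_mulE _ _ (leqnn m)).
transitivity ((fps_trunc m f * fps_trunc m g * fps_trunc m h)`_m).
  rewrite -mulrA !coefM; apply: eq_bigr => i _; congr (_ * _).
  by rewrite fps_truncE ?leq_subr// (fps_mulE _ _ (leq_subr i m)).
rewrite [LHS]coefM [RHS]coefM; apply: eq_bigr => i _; congr (_ * _).
have leim : (i <= m)%N by rewrite -ltnS.
by rewrite fps_truncE // (fps_mulE _ _ leim).
Qed.

Fact fps_mul1 : left_id fps_one fps_mul.
Proof.
move=> f; apply: fpsP => m /=; rewrite big_ord_recl /= mul1r subn0.
by rewrite big1 ?addr0 // => i _; rewrite mul0r.
Qed.

Fact fps_mulDl : left_distributive fps_mul fps_add.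
Proof.
move=> f g h; apply: fpsP => m /=; rewrite -big_split /=.
by apply: eq_bigr => i _; rewrite mulrDl.
Qed.

Fact fps_one_neq0 : fps_one != 0.
Proof.
apply/eqP => /(congr1 (fun f : fps K => f 0%N)) /= /eqP.
by rewrite oner_eq0.
Qed.

HB.instance Definition _ := GRing.Zmodule_isComNzRing.Build (fps K)
  fps_mulA fps_mulC fps_mul1 fps_mulDl fps_one_neq0.

Fact fps_coefM f g m : (f * g) m = \sum_(i < m.+1) f i * g (m - i)%N.
Proof. by []. Qed.

Fact fps_coefX_small h n m : h 0%N = 0 -> (m < n)%N -> (h ^+ n) m = 0.
Proof.
move=> h0; elim: n m => // n IHn m; rewrite ltnS => lemn.
rewrite exprS fps_coefM big_ord_recl h0 mul0r add0r big1 // => i _.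
by rewrite IHn ?mulr0 // /bump /=; case: m lemn i => [|m] // ltmn i;
  rewrite ?subn0 ?subSS ?(leq_ltn_trans (leq_subr _ _)) //; case: i.
Qed.

(* f is invertible iff f 0 != 0; then f = f(0) (1 - h) with h 0 = 0 and f^-1
   is obtained from the geometric series in h. *)
Definition fps_unit : pred (fps K) := fun f => f 0%N != 0.
Definition fps_tail f : fps K := 1 - fps_const (f 0%N)^-1 * f.
Definition fps_geom h : fps K := Fps (fun m => \sum_(k < m.+1) (h ^+ k) m).
Definition fps_inv f : fps K :=
  if fps_unit f then fps_const (f 0%N)^-1 * fps_geom (fps_tail f) else f.

Fact fps_coef_sum n (F : 'I_n -> fps K) m :
  (\sum_(k < n) F k) m = \sum_(k < n) F k m.
Proof.
by apply: (big_morph (fun f : fps K => f m)) => //.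
Qed.

Fact fps_geomP h : h 0%N = 0 -> (1 - h) * fps_geom h = 1.
Proof.
move=> h0; apply: fpsP => m.
have geomE i : (i <= m)%N -> fps_geom h i = (\sum_(k < m.+1) h ^+ k) i.
  move=> leim; rewrite fps_coef_sum /=.
  rewrite -(subnKC leim) -addSn big_split_ord /= [X in _ + X]big1 ?addr0 //.
  by move=> k _; rewrite fps_coefX_small // leq_addr.
rewrite fps_coefM.
transitivity (((1 - h) * \sum_(k < m.+1) h ^+ k) m).
  by rewrite fps_coefM; apply: eq_bigr => i _; rewrite geomE ?leq_subr.
have -> : (1 - h) * (\sum_(k < m.+1) h ^+ k) = 1 - h ^+ m.+1.
  by rewrite -opprB mulNr -subrX1 opprB.
by rewrite /= fps_coefX_small // subr0.
Qed.

Fact fps_coefCM c f m : (fps_const c * f) m = c * f m.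
Proof.
rewrite fps_coefM big_ord_recl /= subn0 big1 ?addr0 // => i _.
by rewrite mul0r.
Qed.

Fact fps_mulVr : {in fps_unit, left_inverse 1 fps_inv *%R}.
Proof.
move=> f; rewrite /in_mem /= => uf; rewrite /fps_inv uf.
have t0 : fps_tail f 0%N = 0.
  by rewrite /fps_tail /= big_ord1 /= mulVf ?subrr.
rewrite mulrAC -[RHS](fps_geomP t0) /fps_tail; congr (_ * _).
by rewrite opprB addrC subrK.
Qed.

Fact fps_unitPl f g : g * f = 1 -> f \in fps_unit.
Proof.
move/(congr1 (fun h : fps K => h 0%N)); rewrite fps_coefM big_ord1 /= => gf.
by apply/eqP => f0; move/eqP: gf; rewrite f0 mulr0 eq_sym oner_eq0.
Qed.

Fact fps_inv_out : {in [predC fps_unit], fps_inv =1 id}.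
Proof. by move=> f; rewrite !inE /in_mem /fps_inv /= => /negbTE ->. Qed.

HB.instance Definition _ := GRing.ComNzRing_hasMulInverse.Build (fps K)
  fps_mulVr fps_unitPl fps_inv_out.

Definition fps_q : fps K := Fps (fun m => if m == 1%N then 1 else 0).

(* Sum of a locally finite family: for each m only finitely many l may have
   F l m <> 0.  The finitely supported sum is 0 by convention otherwise. *)
Definition fps_sum (F : nat -> fps K) : fps K :=
  Fps (fun m => \sum_(l \in [set: nat]) F l m).

End FpsRing.

Arguments fps_q {K}.
Notation "c %:S" := (fps_const c) (at level 2, format "c %:S") : ring_scope.

Definition fps_map (K L : Type) (phi : K -> L) (f : fps K) : fps L :=
  Fps (fun m => phi (f m)).

Section Jacobi.
Variable R : realType.

Definition alpha (k : nat) : R := (- 4) ^- k * 'C((2 * k)%N, k)%:R.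

Definition c0 (m : nat) : R :=
  if odd m then 0
  else (-1) ^+ m./2 *
       derive1n m (fun x : R => (expR x + expR (- x)) `^ (- 2^-1)) 0.

Definition c (m : nat) : fps R :=
  if odd m then 0
  else (c0 m)%:S + (2 * (-1) ^+ m./2)%:S *
       fps_sum (fun l => (alpha l * (2^-1 + 2 * l%:R) ^+ m)%:S *
                         (fps_q ^+ (2 * l)%N.+1 / (1 - fps_q ^+ (2 * l)%N.+1))).

Definition hankelD (n : nat) : fps R :=
  \det (\matrix_(i < n.+1, j < n.+1) c (i + j)%N).

Definition hankelD_pred (n : nat) : fps R :=
  if n is m.+1 then hankelD m else 1.

Definition asq (n : nat) : fps R :=
  hankelD_pred n * hankelD n.+1 / hankelD n ^+ 2.

Definition asq_pred (n : nat) : fps R := if n is m.+1 then asq m else 0.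

(* The solution of - i d_n = - 2 n - 1/2 + a(n)^2 - a(n-1)^2. *)
Definition d (n : nat) : fps R[i] :=
  ('i%C)%:S * fps_map (real_complex R)
    ((- 2 * n%:R - 2^-1)%:S + asq n - asq_pred n).

Definition rising (a : R) (k : nat) : R := \prod_(i < k) (a + i%:R).

(* The sum is the limit of the partial sums, since the series need not
   converge absolutely at z = -1. *)
Definition hyp2F1 (a b e z : R) : R :=
  limn (series (fun k => rising a k * rising b k / (rising e k * k`!%:R) * z ^+ k)).

End Jacobi.

(* Main.v *)
(** Modulo q^3 only the term l = 0 of the Lambert series survives, so with
    t = q + q^2 the moments c(j) are those of the measure at q = 0 perturbed by
    the mass t at each of the points i/2 and -i/2.  The measure at q = 0 is the
    Meixner-Pollaczek one: the derivatives at 0 of f = (2 cosh x)^(-1/2) are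
    governed by v_k = (-1)^k (1/2)_k tanh^k f, which satisfy
    v_k' = v_(k+1) - b_k v_(k-1) with b_k = k (k - 1/2).  This triangularizes the
    Hankel matrix, and since the orthogonal polynomials take the explicit values
    (+-i)^k (1/2)_k at +-i/2, the rank two perturbation has the determinant
    (1 + t K)^2 - (t K')^2, where K = sqrt 2 * sum_(k <= n) alpha_k and
    K' = sqrt 2 * (2 n + 1) * alpha_n.  Expanding D_(n-1) D_(n+1) / D_n^2 to order
    two expresses the coefficient of q^2 through
    1/sqrt 2 - sum_(k < n) alpha_k, which is the tail of the binomial series of
    (1 + x)^(-1/2) at x = 1 and hence equals alpha_n Y. *)

From HB Require Import structures.
Require Import Defs.
From mathcomp Require Import all_boot all_order all_algebra.
From mathcomp Require Import all_classical all_reals all_analysis.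
From mathcomp Require Import complex polyrcf.
From mathcomp Require Import zify ring lra.

Import Order.TTheory GRing.Theory Num.Theory.
Import numFieldNormedType.Exports.

Local Open Scope ring_scope.

(** * Power series modulo q^N and determinants *)

Definition eqmodq {K : fieldType} (N : nat) (f g : fps K) : Prop :=
  forall m, (m < N)%N -> f m = g m.

Lemma eqmodq_refl {K : fieldType} N (f : fps K) : eqmodq N f f.
Proof. by []. Qed.

Lemma eqmodq_sym {K : fieldType} N (f g : fps K) :
  eqmodq N f g -> eqmodq N g f.
Proof. by move=> fg m /fg. Qed.

Lemma eqmodq_trans {K : fieldType} N (f g h : fps K) :
  eqmodq N f g -> eqmodq N g h -> eqmodq N f h.
Proof. by move=> fg gh m mN; rewrite fg ?gh. Qed.

Lemma eqmodqD {K : fieldType} N (f f' g g' : fps K) :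
  eqmodq N f f' -> eqmodq N g g' -> eqmodq N (f + g) (f' + g').
Proof. by move=> ff gg m mN /=; rewrite ff ?gg. Qed.

Lemma eqmodqM {K : fieldType} N (f f' g g' : fps K) :
  eqmodq N f f' -> eqmodq N g g' -> eqmodq N (f * g) (f' * g').
Proof.
move=> ff gg m mN; rewrite !fps_coefM; apply: eq_bigr => i _.
rewrite ff ?gg ?(leq_ltn_trans (leq_subr _ _)) //.
by apply: leq_ltn_trans mN; rewrite -ltnS.
Qed.

Lemma eqmodq_det {K : fieldType} N n (A B : 'M[fps K]_n) :
  (forall i j, eqmodq N (A i j) (B i j)) -> eqmodq N (\det A) (\det B).
Proof.
move=> AB; apply: (big_ind2 (eqmodq N)) => //.
  by move=> *; exact: eqmodqD.
move=> s _; apply: eqmodqM => //.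
by apply: (big_ind2 (eqmodq N)) => // *; exact: eqmodqM.
Qed.

Lemma eqmodq_mulIr {K : fieldType} N (f g u : fps K) :
  u \is a GRing.unit -> eqmodq N (f * u) (g * u) -> eqmodq N f g.
Proof.
by move=> uu /eqmodqM/(_ (eqmodq_refl N u^-1)); rewrite !mulrK.
Qed.

Lemma fps_unitE {K : fieldType} (f : fps K) :
  (f \is a GRing.unit) = (f 0%N != 0).
Proof. by []. Qed.

Lemma fps_constB {K : fieldType} (a b : K) : (a - b)%:S = a%:S - b%:S.
Proof. by apply: fpsP => -[|m] //=; rewrite subr0. Qed.

Lemma fps_constM {K : fieldType} (a b : K) : (a * b)%:S = a%:S * b%:S.
Proof. by apply: fpsP => m; rewrite fps_coefCM /=; case: m => //= m; rewrite mulr0. Qed.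

HB.instance Definition _ (K : fieldType) :=
  GRing.isZmodMorphism.Build K (fps K) (@fps_const K) (@fps_constB K).
HB.instance Definition _ (K : fieldType) :=
  GRing.isMonoidMorphism.Build K (fps K) (@fps_const K)
    (conj (erefl : (1 : K)%:S = 1) (@fps_constM K)).

(** Both sides come from the determinant of the block matrix [E], factored through the Schur
    complement of either diagonal block. *)
Lemma det_addM {A : comNzRingType} (n p : nat) (D D' : 'M[A]_n)
    (U : 'M[A]_(n, p)) (V : 'M[A]_(p, n)) : D' *m D = 1%:M ->
  \det (D + U *m V) = \det D * \det (1%:M + V *m D' *m U).
Proof.
move=> D'D.
pose E := block_mx D (- U) V 1%:M.
have E1 : E = block_mx 1%:M 0 (V *m D') 1%:M *m
              block_mx D (- U) 0 (1%:M + V *m D' *m U).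
  rewrite mulmx_block !mul1mx !mul0mx ?mulmx0 !addr0 -mulmxA D'D mulmx1.
  by rewrite mulmxN addrCA addNr addr0.
have E2 : E = block_mx 1%:M (- U) 0 1%:M *m block_mx (D + U *m V) 0 V 1%:M.
  rewrite mulmx_block !mul1mx !mul0mx ?mulmx0 mulmx1 !add0r.
  by rewrite mulNmx addrK.
have := congr1 determinant E1; rewrite E2 !det_mulmx.
by rewrite !det_ublock !det_lblock !det1 !mul1r !mulr1.
Qed.

Lemma det_mx22 {A : comNzRingType} (M : 'M[A]_2) :
  \det M = M 0 0 * M 1 1 - M 0 1 * M 1 0.
Proof.
rewrite (expand_det_row _ 0) !big_ord_recl big_ord0 addr0 /cofactor !det_mx11.
rewrite !mxE /= expr0 expr1 mul1r mulN1r mulrN; congr (_ * M _ _ - M _ _ * M _ _);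
  exact: val_inj.
Qed.

(** * Stieltjes matrices *)

(* If P_0 = 1 and P_(k+1) = X P_k + b_k P_(k-1), then
   X^m = sum_k (stieltjes b m k) P_k; the sign of b is chosen so that the
   polynomials stay real, i.e. P_k(x) = i^k p_k(x / i) for the
   orthogonal polynomials p_k of the moments c_0. *)
Fixpoint stieltjes {A : comNzRingType} (b : nat -> A) (m k : nat) : A :=
  if m is m'.+1 then
    (if k is k'.+1 then stieltjes b m' k' else 0) - b k.+1 * stieltjes b m' k.+1
  else (k == 0%N)%:R.

(** The value on X^m of the linear functional sending P_k to [w k]. *)
Definition stieltjes_sum {A : comNzRingType} (b : nat -> A) (m : nat)
  (w : nat -> A) : A := \sum_(k < m.+1) stieltjes b m k * w k.

Lemma stieltjes_gt {A : comNzRingType} (b : nat -> A) m k :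
  (m < k)%N -> stieltjes b m k = 0.
Proof.
elim: m k => [|m IHm] [|k] //= lt_mk.
by rewrite !IHm ?mulr0 ?subr0 // ltnW // ltnW.
Qed.

Lemma stieltjes_diag {A : comNzRingType} (b : nat -> A) m : stieltjes b m m = 1.
Proof.
by elim: m => //= m IHm; rewrite IHm stieltjes_gt ?mulr0 ?subr0 // ltnW.
Qed.

Lemma stieltjes_odd {A : comNzRingType} (b : nat -> A) m k :
  odd (m + k) -> stieltjes b m k = 0.
Proof.
elim: m k => [|m IHm] [|k]; rewrite ?addSn ?addnS ?addn0 //= => o.
  by rewrite IHm ?addn1 // mulr0 subr0.
by rewrite !IHm ?addnS /= ?mulr0 ?subr0 //; rewrite negbK in o.
Qed.

Lemma stieltjes_sum_widen {A : comNzRingType} (b : nat -> A) m n w : (m <= n)%N ->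
  stieltjes_sum b m w = \sum_(k < n.+1) stieltjes b m k * w k.
Proof.
rewrite -ltnS => mn; rewrite /stieltjes_sum.
rewrite (big_ord_widen n.+1 (fun k => stieltjes b m k * w k) mn) big_mkcond /=.
apply: eq_bigr => k _; case: ltnP => // mk.
by rewrite stieltjes_gt ?mul0r.
Qed.

(** Multiplication by X is transposed onto the weights, using X P_k = P_(k+1) - b_k P_(k-1). *)
Lemma stieltjes_sumS {A : comNzRingType} (b : nat -> A) m w :
  stieltjes_sum b m.+1 w =
  stieltjes_sum b m (fun k => w k.+1 - (if k is k'.+1 then b k * w k' else 0)).
Proof.
rewrite /stieltjes_sum.
under eq_bigr do rewrite /= mulrBl.
under [RHS]eq_bigr do rewrite mulrBr.
rewrite !sumrB; congr (_ - _).
  by rewrite big_ord_recl mul0r add0r.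
rewrite [RHS]big_ord_recl mulr0 add0r.
rewrite 2!big_ord_recr /= !stieltjes_gt // !mulr0 !mul0r !addr0.
by apply: eq_bigr => k _; rewrite mulrCA mulrA.
Qed.

Lemma eq_stieltjes_sum {A : comNzRingType} (b : nat -> A) m w w' : w =1 w' ->
  stieltjes_sum b m w = stieltjes_sum b m w'.
Proof. by move=> ww; apply: eq_bigr => k _; rewrite ww. Qed.

(** The hypotheses force [w k] = P_k(x), so the sum is the expansion of X^m evaluated at x. *)
Lemma stieltjes_sum_eigen {A : comNzRingType} (b : nat -> A) x w m :
  w 0%N = 1 ->
  (forall k, w k.+1 - (if k is k'.+1 then b k * w k' else 0) = x * w k) ->
  stieltjes_sum b m w = x ^+ m.
Proof.
move=> w0 wS; elim: m => [|m IHm].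
  by rewrite /stieltjes_sum big_ord1 w0 mulr1.
rewrite stieltjes_sumS (eq_stieltjes_sum _ _ _ _ wS) exprS -IHm.
by rewrite /stieltjes_sum mulr_sumr; apply: eq_bigr => k _; rewrite mulrCA.
Qed.

(** The hypothesis on [H] makes multiplication by X symmetric for the form in which the P_k are
    orthogonal with squares [H k]; the induction moves one factor X at a time from X^m to X^p. *)
Lemma stieltjes_sum_moment {A : comNzRingType} (b H : nat -> A) m p :
  (forall k, H k.+1 = - b k.+1 * H k) ->
  stieltjes_sum b m (fun k => stieltjes b p k * H k) =
  stieltjes b (m + p) 0 * H 0%N.
Proof.
move=> HS; elim: m p => [|m IHm] p.
  by rewrite /stieltjes_sum big_ord1 mul1r.
rewrite addSnnS -IHm stieltjes_sumS; apply: eq_stieltjes_sum => k /=.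
by case: k => [|k]; rewrite !HS; ring.
Qed.

(** * Partial sums of alpha *)

Lemma alpha0 {R : realType} : alpha R 0 = 1.
Proof. by rewrite /alpha expr0 invr1 bin0 mul1r. Qed.

Lemma alphaS {R : realType} n :
  alpha R n.+1 = - ((2 * n%:R + 1) / (2 * n%:R + 2)) * alpha R n.
Proof.
have := mul_bin_diag (2 * n.+1) n; rewrite mulnS add2n /= => e1.
have := mul_bin_down (2 * n).+1 n; rewrite /= subSn ?leq_pmull // => e2.
have {}e1 : (2 * n%:R + 2) * 'C((2 * n).+1, n)%:R
            = (n%:R + 1) * 'C((2 * n).+2, n.+1)%:R :> R.
  by rewrite natr1 -natrM -natrD addn2 -!natrM e1.
have {}e2 : (2 * n%:R + 1) * 'C(2 * n, n)%:R
            = (n%:R + 1) * 'C((2 * n).+1, n)%:R :> R.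
  rewrite -natrM !natr1 -!natrM e2; congr (_%:R); congr (_.+1 * _)%N; lia.
rewrite /alpha mulnS add2n exprS.
have n0 : n%:R + 1 != 0 :> R by rewrite natr1 pnatr_eq0.
have -> : 'C((2 * n).+2, n.+1)%:R
          = 2 * (2 * n%:R + 1) * 'C(2 * n, n)%:R / (n%:R + 1) :> R.
  apply: (mulfI n0); rewrite -e1; apply: (mulfI n0).
  rewrite mulrCA -e2; field; exact: n0.
field; rewrite n0 expf_neq0 //=; lra.
Qed.

Lemma alpha_neq0 {R : realType} n : alpha R n != 0.
Proof.
elim: n => [|n IHn]; first by rewrite alpha0 oner_eq0.
have n0 : 0 <= n%:R :> R by [].
by rewrite alphaS mulf_neq0 // oppr_eq0 mulf_neq0 ?invr_eq0 //; apply/eqP; lra.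
Qed.

(** Consecutive values have ratio (2n+1)(2n+3)/(2n+2)^2 < 1. The bound forces alpha_n to tend to 0,
    which convergence at the boundary point x = 1 requires. *)
Lemma alpha_sqr_le {R : realType} n : alpha R n ^+ 2 * (2 * n%:R + 1) <= 1.
Proof.
elim: n => [|n IHn]; first by rewrite alpha0; lra.
apply: le_trans IHn; rewrite alphaS -[n.+1%:R]natr1.
have n0 : 0 <= n%:R :> R by [].
set x := n%:R in n0 *; set a := alpha R n.
have x2 : 2 * x + 2 != 0 by lra.
have -> : (- ((2 * x + 1) / (2 * x + 2)) * a) ^+ 2 * (2 * (x + 1) + 1) =
  a ^+ 2 * (2 * x + 1) * ((2 * x + 1) * (2 * x + 3) / (2 * x + 2) ^+ 2).
  by field.
rewrite ler_piMr //; first by rewrite mulr_ge0 ?sqr_ge0; lra.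
by rewrite ler_pdivrMr ?exprn_gt0; lra.
Qed.

Definition alpha_sum (R : realType) (n : nat) : R := \sum_(k < n) alpha R k.

(* The derivative of psi(y) = y sum_(k <= n) alpha_k (y^2 - 1)^k collapses to
   (2 n + 1) alpha_n (y^2 - 1)^n; on [1, sqrt 2] it is dominated by the derivative
   of |alpha_n| (y^2 - 1)^(n+1). *)
Lemma alpha_sum_dist {R : realType} n :
  `|1 - Num.sqrt 2 * alpha_sum R n.+1| <= `|alpha R n|.
Proof.
rewrite /alpha_sum; move: (alpha R) (@alpha0 R) (@alphaS R) => al al0 alS.
pose w : {poly R} := 'X ^+ 2 - 1%:P.
pose psi m : {poly R} := \sum_(k < m.+1) al k *: ('X * w ^+ k).
have dw : w^`() = 2%:R *: 'X.
  by rewrite derivB derivXn derivC subr0 /= expr1 scaler_nat.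
have dpsi m y : (psi m)^`().[y]
    = (2 * m%:R + 1) * al m * (y ^+ 2 - 1) ^+ m.
  elim: m => [|m IHm].
    by rewrite /psi big_ord1 al0 scale1r /= !expr0 mulr1 derivX !hornerE; ring.
  rewrite /psi big_ord_recr derivD hornerD IHm /= derivZ derivM derivX.
  rewrite deriv_exp /= dw !(hornerE, hornerMn, horner_exp) /w ?hornerE !alS.
  have m0 : 2 * m%:R + 2 != 0 :> R by rewrite -natrM -natrD addn2 pnatr_eq0.
  move: (al m) => a.
  rewrite -[_ *+ m.+1]mulr_natl [_ ^+ m.+1]exprS -[m.+1%:R]natr1.
  move: (_ ^+ m) => z. by field.
(* The signs s = 1 and s = -1 give the two halves of the absolute value. The polynomial [p] is
   nondecreasing on [1, sqrt 2], where y^2 - 1 runs from 0 to 1, and its endpoint values are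
   compared. *)
have key (s : R) : s ^+ 2 = 1 ->
    s <= `|al n| + s * (Num.sqrt 2 * (\sum_(k < n.+1) al k)).
  move=> s2.
  pose p := `|al n| *: w ^+ n.+1 + s *: psi n.
  have s2E : Num.sqrt 2 ^+ 2 = 2 :> R by rewrite sqr_sqrtr.
  have le1s : 1 <= Num.sqrt 2 :> R by rewrite -[X in X <= _]sqrtr1 ler_wsqrtr ?ler1n.
  have psi1 : (psi n).[1] = 1.
    rewrite /psi big_ord_recl hornerD horner_sum big1 ?addr0 => [|k _].
      by rewrite al0 !hornerE.
    by rewrite /w !hornerE expr1n subrr expr0n /= !mulr0.
  have psi2 : (psi n).[Num.sqrt 2] = Num.sqrt 2 * (\sum_(k < n.+1) al k).
    rewrite /psi horner_sum mulr_sumr; apply: eq_bigr => k _.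
    rewrite /w !hornerE s2E.
    have -> : 2 - 1 = 1 :> R by ring.
    by rewrite expr1n /= mulr1 mulrC.
  have p1 : p.[1] = s.
    by rewrite !hornerE psi1 ?horner_exp /w ?hornerE expr1n subrr expr0n /=; ring.
  have p2 : p.[Num.sqrt 2]
      = `|al n| + s * (Num.sqrt 2 * (\sum_(k < n.+1) al k)).
    rewrite !hornerE psi2 ?horner_exp /w ?hornerE s2E.
    have -> : 2 - 1 = 1 :> R by ring.
    by rewrite expr1n /=; ring.
  rewrite -[X in X <= _]p1 -p2.
  apply: (@polyrcf.ler_hornerW _ 1 (Num.sqrt 2)); rewrite ?in_itv /= ?lexx ?le1s //.
  move=> y; rewrite in_itv /= => /andP[lt1y _].
  rewrite derivD !derivZ deriv_exp dw /= !(hornerE, hornerMn, horner_exp) dpsi.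
  rewrite /w ?hornerE -[_ *+ n.+1]mulr_natl -[n.+1%:R]natr1.
  move: (al n) => a; set z := (y ^+ 2 - 1) ^+ n.
  have z0 : 0 <= z by apply: exprn_ge0; nra.
  have n0 : 0 <= n%:R :> R by [].
  have sa : - `|a| <= s * a.
    rewrite lerNl -mulNr; apply: le_trans (ler_norm _) _.
    rewrite normrM normrN (_ : `|s| = 1) ?mul1r //.
    by apply/eqP; rewrite -(@eqrXn2 _ 2) // -normrX s2 normr1 expr1n.
  rewrite /=.
  (* The derivative of [p] is regrouped into terms that are nonnegative because s a >= -|a| and y >
     1. *)
  have -> : `|a| * ((n%:R + 1) * (2 * y * z)) + s * (2 * n%:R + 1) * a * z =
    z * ((2 * n%:R + 1) * (s * a + `|a|)
         + `|a| * (2 * (n%:R + 1) * (y - 1) + 1)) by ring.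
  by rewrite mulr_ge0 // addr_ge0 // mulr_ge0 //; nra.
rewrite ler_norml; apply/andP; split.
  by have := key (- 1); rewrite sqrrN expr1n => /(_ erefl); lra.
by have := key 1; rewrite expr1n => /(_ erefl); lra.
Qed.

Lemma cvg_alpha_sum {R : realType} :
  (alpha_sum R @ \oo --> (Num.sqrt 2)^-1)%classic.
Proof.
rewrite -cvg_shiftS; apply/cvgrPdist_le => e e0.
have e20 : 0 < e ^+ 2 by rewrite exprn_gt0.
near=> n.
have s20 : 0 < Num.sqrt 2 :> R by rewrite sqrtr_gt0.
have le1s : 1 <= Num.sqrt 2 :> R by rewrite -[X in X <= _]sqrtr1 ler_wsqrtr ?ler1n.
rewrite /= (_ : _ - _ =
    (Num.sqrt 2)^-1 * (1 - Num.sqrt 2 * alpha_sum R n.+1)); last first.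
  by rewrite mulrBr mulr1 mulrA mulVf ?gt_eqF // mul1r.
rewrite normrM; apply: (@le_trans _ _ `|1 - Num.sqrt 2 * alpha_sum R n.+1|).
  by rewrite ler_piMl // ger0_norm ?invr_ge0 ?(ltW s20) // invf_le1.
apply: le_trans (alpha_sum_dist n) _.
rewrite -(@ler_pXn2r _ 2) ?nnegrE ?(ltW e0) // real_normK ?num_real //.
have : n.+1%:R^-1 < e ^+ 2.
  by near: n; exact: (near_infty_natSinv_lt (PosNum e20)).
move/ltW; apply: le_trans; rewrite -[leRHS]mul1r ler_pdivlMr //.
apply: le_trans (alpha_sqr_le n); rewrite ler_wpM2l ?sqr_ge0 //.
by rewrite -[n.+1%:R]natr1; have : 0 <= n%:R :> R by []; lra.
Unshelve. all: end_near. Qed.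

Lemma alphaD {R : realType} n k :
  alpha R (n + k) =
  alpha R n * (rising (n%:R + 2^-1) k / rising (n%:R + 1) k * (- 1) ^+ k).
Proof.
elim: k => [|k IHk]; first by rewrite addn0 /rising !big_ord0; field.
rewrite addnS alphaS IHk /rising !big_ord_recr /= -!/(rising _ _) exprS natrD.
have r0 : rising (n%:R + 1 : R) k != 0.
  by apply/prodf_neq0 => i _; rewrite -addrA nat1r -natrD addnS pnatr_eq0.
have nk : n%:R + 1 + k%:R != 0 :> R.
  by rewrite natr1 -natrD pnatr_eq0.
field; rewrite nk r0 /= (_ : _ + 2 = 2 * (n%:R + 1 + k%:R)); last by ring.
by rewrite mulf_neq0.
Qed.

(** As (1)_k = k!, [alphaD] makes the k-th term of the hypergeometric series equal to alpha_(n+k) /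
    alpha_n; hence alpha_n Y is the tail from index n of a series with sum 1 / sqrt 2. *)
Lemma alpha_hyp2F1 {R : realType} n :
  alpha R n * hyp2F1 1 (n%:R + 2^-1) (n%:R + 1) (- 1) =
  (Num.sqrt 2)^-1 - alpha_sum R n.
Proof.
have rising1 k : rising (1 : R) k = k`!%:R.
  elim: k => [|k IHk]; rewrite /rising ?big_ord0 //.
  by rewrite big_ord_recr /= -/(rising _ _) IHk nat1r -natrM mulnC.
rewrite -[RHS](mulVKf (alpha_neq0 n)); congr (_ * _).
apply: cvg_lim => //.
have -> : series (fun k => rising 1 k * rising (n%:R + 2^-1) k /
      (rising (n%:R + 1) k * k`!%:R) * (- 1) ^+ k) =
    (fun N => (alpha R n)^-1 * (alpha_sum R (N + n) - alpha_sum R n)).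
  apply: funext => N; rewrite /series /= /alpha_sum.
  have -> : \sum_(k < N + n) alpha R k
      = \sum_(k < n) alpha R k + \sum_(0 <= k < N) alpha R (n + k).
    by rewrite addnC big_split_ord big_mkord.
  rewrite addrAC subrr add0r mulr_sumr; apply: eq_bigr => k _.
  have k0 : k`!%:R != 0 :> R by rewrite pnatr_eq0 -lt0n fact_gt0.
  rewrite alphaD mulKf ?alpha_neq0 // rising1; congr (_ * _).
  by rewrite [k`!%:R * _]mulrC -mulf_div divff // mulr1.
apply: cvgMr; apply: cvgB; last exact: cvg_cst.
by rewrite cvg_shiftn; exact: cvg_alpha_sum.
Qed.

(** * The moments at q = 0 *)

Definition cosh2 {R : realType} (x : R) : R := expR x + expR (- x).
Definition tanhR {R : realType} (x : R) : R :=
  (expR x - expR (- x)) * (cosh2 x)^-1.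

Definition meixner_b {R : realType} (k : nat) : R := k%:R * (k%:R - 2^-1).

Definition meixner_fun {R : realType} (k : nat) (x : R) : R :=
  (- 1) ^+ k * rising 2^-1 k * tanhR x ^+ k * cosh2 x `^ (- 2^-1).

Lemma cosh2_gt0 {R : realType} (x : R) : 0 < cosh2 x.
Proof. by rewrite addr_gt0 ?expR_gt0. Qed.

Lemma is_derive_cosh2 {R : realType} (x : R) :
  is_derive x 1 cosh2 (expR x - expR (- x)).
Proof.
apply: is_derive_eq.
by rewrite mulrN mulr1.
Qed.

Lemma is_derive_tanhR {R : realType} (x : R) :
  is_derive x 1 tanhR (1 - tanhR x ^+ 2).
Proof.
have c0 : cosh2 x != 0 by rewrite gt_eqF // cosh2_gt0.
have ? := is_derive_cosh2 x.
have ? := is_deriveV c0 (is_derive_cosh2 x).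
apply: is_derive_eq.
rewrite /tanhR /GRing.scale /= /cosh2; rewrite /cosh2 in c0.
by field.
Qed.

Lemma is_derive_powR_cosh2 {R : realType} (x : R) :
  is_derive x 1 (fun y => cosh2 y `^ (- 2^-1))
    (- 2^-1 * tanhR x * cosh2 x `^ (- 2^-1)).
Proof.
have cp := cosh2_gt0 x.
have h := is_derive1_comp (is_derive1_powR (- 2^-1) cp)
           (is_derive_cosh2 x).
apply: (is_derive_eq h).
rewrite powRB ?(gt_eqF cp) ?implybT // powRr1 ?ltW // /tanhR.
by field; rewrite gt_eqF.
Qed.

(** With f = [cosh2] to the power -1/2, (tanh^k f)' = k tanh^(k-1) f - (k + 1/2) tanh^(k+1) f; the
    factor (-1)^k (1/2)_k normalizes the coefficient of the raised term to 1. *)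
Lemma is_derive_meixner_fun {R : realType} k (x : R) :
  is_derive x 1 (meixner_fun k)
    (meixner_fun k.+1 x
     - (if k is k'.+1 then meixner_b k * meixner_fun k' x else 0)).
Proof.
have ? := is_derive_tanhR x; have ? := is_derive_powR_cosh2 x.
have -> : meixner_fun k = ((- 1) ^+ k * rising 2^-1 k) *:
    (tanhR ^+ k * (fun y => cosh2 y `^ (- 2^-1))) :> (R -> R).
  apply: funext => y; rewrite /meixner_fun -[LHS]mulrA [RHS]/= /GRing.scale /=.
  by rewrite !mulrfctE exprfctE.
apply: is_derive_eq.
rewrite /meixner_fun /meixner_b /GRing.scale /= exprfctE.
case: k => [|k]; rewrite /rising !big_ord_recr ?big_ord0 /= -?/(rising _ _).
  by rewrite !expr0 expr1 mul0r; ring.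
by rewrite !exprS -natr1; field.
Qed.

(** Differentiation acts on the [meixner_fun k] as multiplication by X acts on the P_k, so the
    expansion of X^m carries over to the m-th derivative. *)
Lemma derive1n_meixner {R : realType} m :
  derive1n m (fun x : R => cosh2 x `^ (- 2^-1)) =
  fun x => stieltjes_sum meixner_b m (fun k => meixner_fun k x).
Proof.
elim: m => [|m IHm].
  apply: funext => x; rewrite derive1n0 /stieltjes_sum big_ord1 /= mul1r.
  by rewrite /meixner_fun /rising big_ord0 !expr0 !mul1r.
rewrite derive1nS IHm; apply: funext => x; rewrite derive1E.
rewrite stieltjes_sumS.
have -> : (fun y : R => stieltjes_sum meixner_b m (fun k => meixner_fun k y)) =
    \sum_(k < m.+1) (stieltjes meixner_b m k *: meixner_fun k).
  by apply: funext => y; rewrite fct_sumE.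
apply: derive_val; apply: is_derive_sum => k.
by apply: is_deriveZ; exact: is_derive_meixner_fun.
Qed.

(** At 0 the hyperbolic tangent vanishes, which leaves only the term k = 0, and [cosh2] is 2. *)
Lemma c0E {R : realType} m : ~~ odd m ->
  c0 R m = (- 1) ^+ m./2 * (stieltjes meixner_b m 0 / Num.sqrt 2).
Proof.
move=> /negbTE om; rewrite /c0 om; congr (_ * _).
have := congr1 (@^~ 0) (@derive1n_meixner R m).
rewrite /= /cosh2 => ->; rewrite /stieltjes_sum big_ord_recl big1 ?addr0 => [|k _].
  rewrite /meixner_fun /rising big_ord0 !expr0 !mul1r /cosh2 oppr0 expR0.
  by rewrite (_ : 1 + 1 = 2) // powRN powR12_sqrt.
by rewrite /meixner_fun /tanhR oppr0 subrr mul0r expr0n /= !(mul0r, mulr0).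
Qed.

(** * The moments modulo q^3 *)

Lemma fps_coef_qM0 {K : fieldType} (f : fps K) : (fps_q * f) 0%N = 0.
Proof. by rewrite fps_coefM big_ord1 mul0r. Qed.

Lemma fps_coef_qMS {K : fieldType} (f : fps K) m : (fps_q * f) m.+1 = f m.
Proof.
rewrite fps_coefM 2!big_ord_recl mul0r add0r mul1r subn1 big1 ?addr0 // => i _.
by rewrite mul0r.
Qed.

Lemma fps_coef_qXM_lt {K : fieldType} (f : fps K) n m :
  (m < n)%N -> (fps_q ^+ n * f) m = 0.
Proof.
elim: n m => // n IHn [|m] lt; rewrite exprS -mulrA ?fps_coef_qM0 //.
by rewrite fps_coef_qMS IHn.
Qed.

Lemma lambert0_eqmodq {K : fieldType} :
  eqmodq 3 (fps_q / (1 - fps_q) : fps K) (fps_q + fps_q ^+ 2).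
Proof.
have u : (1 - fps_q : fps K) \is a GRing.unit.
  by rewrite fps_unitE /= subr0 oner_eq0.
have -> : fps_q / (1 - fps_q) =
    fps_q + fps_q ^+ 2 + fps_q ^+ 3 / (1 - fps_q) :> fps K.
  by apply: (mulIr u); rewrite mulrDl !divrK //; ring.
move=> m m3; have := fps_coef_qXM_lt (1 - fps_q : fps K)^-1 _ _ m3.
by move=> /= ->; rewrite addr0.
Qed.

(** Below order N the family is supported on the index 0, so the default value of an infinitely
    supported sum does not intervene. *)
Lemma fps_sum_head {K : fieldType} N (F : nat -> fps K) :
  (forall l, (0 < l)%N -> eqmodq N (F l) 0) -> eqmodq N (fps_sum F) (F 0%N).
Proof.
move=> F0 m mN; rewrite [LHS]/=.
rewrite -(@fsbig_widen _ _ _ _ [set 0%N]%classic) //; first exact: fsbig_set1.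
by move=> l [_ /eqP]; rewrite -lt0n => l0; exact: F0.
Qed.

(* The sign (-1)^((i+j)/2) is split into a factor depending on i and one depending
   on j, so that the Hankel matrix is a real matrix between two diagonal ones; for
   odd i + j both sides vanish. *)
Lemma c_eqmodq {R : realType} i j :
  eqmodq 3 (c R (i + j))
   (((- 1) ^+ i./2 * (- 1) ^+ uphalf j)%:S *
    ((stieltjes meixner_b (i + j) 0 / Num.sqrt 2)%:S +
     (fps_q + fps_q ^+ 2) * (2^-1 ^+ (i + j) + (- 2^-1) ^+ (i + j))%:S)).
Proof.
case: (boolP (odd (i + j))) => [ dij | eij ].
  rewrite /c dij stieltjes_odd ?addn0 // mul0r.
  rewrite [(- 2^-1) ^+ _]exprNn -[(-1) ^+ (i + j)]signr_odd dij expr1.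
  by rewrite mulN1r subrr rmorph0 mulr0 addr0 mulr0.
have hij : (i./2 + uphalf j = (i + j)./2)%N by lia.
rewrite /c (negbTE eij) c0E // -exprD hij.
(* As i + j is even, the points 1/2 and -1/2 contribute equally, which accounts for the factor 2 in
   [c]. *)
rewrite [(- 2^-1) ^+ _]exprNn -[(-1) ^+ (i + j)]signr_odd (negbTE eij) expr0 mul1r.
set s := (-1) ^+ _; set x := _ / Num.sqrt 2; set p := _ ^+ (i + j).
rewrite mulrDr -!rmorphM; apply: eqmodqD => //.
apply: (@eqmodq_trans _ _ _ ((2 * s)%:S * (p%:S * (fps_q / (1 - fps_q))))).
  apply: eqmodqM => //; apply: eqmodq_trans.
    (* The term of index l starts at q^(2l+1), of order at least 3 once l > 0. *)
    apply: fps_sum_head => l l0 m m3; rewrite fps_coefCM.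
    by rewrite fps_coef_qXM_lt ?mulr0 // (leq_trans m3) // ltnS; lia.
  by rewrite muln0 expr1 mulr0 addr0 alpha0 mul1r.
apply: (@eqmodq_trans _ _ _ ((2 * s)%:S * (p%:S * (fps_q + fps_q ^+ 2)))).
  by apply: eqmodqM => //; apply: eqmodqM => //; exact: lambert0_eqmodq.
have -> // : (2 * s)%:S * (p%:S * (fps_q + fps_q ^+ 2)) =
  s%:S * ((fps_q + fps_q ^+ 2) * (p + p)%:S).
by rewrite fps_constM rmorph_nat [(p + p)%:S]rmorphD; ring.
Qed.

(** * Norms, values at the mass points and kernel sums *)

Definition meixner_norm {R : realType} (k : nat) : R :=
  k`!%:R ^+ 2 * alpha R k / Num.sqrt 2.

(** Identifies the closed form as the product of the -b_j for 1 <= j <= k, divided by sqrt 2: the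
    squares of the P_k. *)
Lemma meixner_normS {R : realType} k :
  meixner_norm k.+1 = - meixner_b k.+1 * meixner_norm k :> R.
Proof.
rewrite /meixner_norm /meixner_b factS natrM alphaS -[k.+1%:R]natr1.
have s20 : Num.sqrt 2 != 0 :> R by rewrite gt_eqF // sqrtr_gt0.
have k0 : 0 <= k%:R :> R by [].
field; rewrite s20 /=; apply/eqP; lra.
Qed.

Lemma meixner_norm_neq0 {R : realType} k : meixner_norm k != 0 :> R.
Proof.
have f0 : k`!%:R != 0 :> R by rewrite pnatr_eq0 -lt0n fact_gt0.
have s20 : Num.sqrt 2 != 0 :> R by rewrite gt_eqF // sqrtr_gt0.
apply: mulf_neq0; last by rewrite invr_eq0.
by apply: mulf_neq0 (alpha_neq0 k); rewrite expf_neq0.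
Qed.

Lemma rising_half {R : realType} k :
  rising 2^-1 k = (- 1) ^+ k * k`!%:R * alpha R k.
Proof.
elim: k => [|k IHk]; first by rewrite /rising big_ord0 alpha0 !mulr1.
rewrite /rising big_ord_recr /= -/(rising _ _) IHk factS natrM alphaS exprS.
rewrite -[k.+1%:R]natr1; have k0 : 0 <= k%:R :> R by [].
by field; apply/eqP; lra.
Qed.

(** This is the k-th term of the Christoffel-Darboux kernel at a mass point, which turns kernel sums
    into sums of alpha. *)
Lemma rising_half_sqr {R : realType} k :
  rising 2^-1 k ^+ 2 / meixner_norm k = Num.sqrt 2 * alpha R k.
Proof.
rewrite rising_half /meixner_norm; have a0 := @alpha_neq0 R k.
have f0 : k`!%:R != 0 :> R by rewrite pnatr_eq0 -lt0n fact_gt0.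
have s20 : Num.sqrt 2 != 0 :> R by rewrite gt_eqF // sqrtr_gt0.
move: (alpha R k) a0 (sqrr_sign R k) => a a0 e2; rewrite !exprMn e2 mul1r.
field; exact/and3P.
Qed.

(** For s = 1 and s = -1 this amounts to P_k(s/2) = s^k (1/2)_k, read off from the recurrence. *)
Lemma meixner_eigen {R : realType} (s : R) m : s ^+ 2 = 1 ->
  stieltjes_sum meixner_b m (fun k => s ^+ k * rising 2^-1 k) = (s / 2) ^+ m.
Proof.
move=> s2; apply: stieltjes_sum_eigen => [|k].
  by rewrite /rising big_ord0 mulr1.
case: k => [|k]; rewrite /rising !big_ord_recr ?big_ord0 /= -?/(rising _ _).
  by rewrite expr0 expr1; ring.
rewrite /meixner_b !exprS -[k.+1%:R]natr1.
move: (s ^+ k) (rising _ k) => z r.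
transitivity (s / 2 * (s * z * (r * (2^-1 + k%:R)))
    + (s ^+ 2 - 1) * ((k%:R + 1) * (k%:R + 2^-1) * z * r)); first by field.
by rewrite s2 subrr mul0r addr0.
Qed.

(** Needed for the kernel between the two distinct mass points, where the values of P_k differ by
    (-1)^k. *)
Lemma alt_alpha_sum {R : realType} n :
  \sum_(k < n.+1) (- 1) ^+ k * alpha R k = (- 1) ^+ n * ((2 * n%:R + 1) * alpha R n).
Proof.
elim: n => [|n IHn]; first by rewrite big_ord1 !expr0; ring.
rewrite big_ord_recr /= IHn alphaS exprS -[n.+1%:R]natr1.
have n0 : 0 <= n%:R :> R by [].
by field; apply/eqP; lra.
Qed.

(** * Hankel determinants and Jacobi coefficients *)

Definition hankel_factor {R : realType} (a b : R) : fps R :=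
  (1 + (fps_q + fps_q ^+ 2) * (Num.sqrt 2 * a)%:S) ^+ 2
  - ((fps_q + fps_q ^+ 2) * (Num.sqrt 2 * b)%:S) ^+ 2.

(** The value at q = 0 of the Hankel determinant of size n. The signs undo the passage from p_k to
    the real polynomials P_k. *)
Definition hankel_const (R : realType) (n : nat) : R :=
  \prod_(k < n) ((- 1) ^+ k * meixner_norm k).

Lemma hankel_const_neq0 {R : realType} n : hankel_const R n != 0.
Proof.
by apply/prodf_neq0 => k _; rewrite mulf_neq0 ?meixner_norm_neq0 ?signr_eq0.
Qed.

(* By Sylvester's identity the determinant of the rank two perturbation reduces to
   a 2 x 2 determinant. *)
Lemma det_meixner_perturbed {R : realType} n (t : fps R) :
  \det (\matrix_(i < n.+1, j < n.+1)
     ((stieltjes meixner_b (i + j) 0 / Num.sqrt 2)%:S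
      + t * (2^-1 ^+ (i + j) + (- 2^-1) ^+ (i + j))%:S)) =
  (\prod_(k < n.+1) meixner_norm k)%:S *
  ((1 + t * (Num.sqrt 2 * alpha_sum R n.+1)%:S) ^+ 2
   - (t * (Num.sqrt 2 * ((2 * n%:R + 1) * alpha R n))%:S) ^+ 2).
Proof.
(* [T *m D *m T^T] is the matrix without perturbation, and the columns of [T *m U] hold the powers
   of 1/2 and -1/2; as [T] is unitriangular, what remains is a diagonal matrix plus a term of rank
   two. *)
pose T := \matrix_(i < n.+1, j < n.+1) (stieltjes (@meixner_b R) i j)%:S.
pose D := diag_mx (\row_(k < n.+1) (@meixner_norm R k)%:S).
pose D' := diag_mx (\row_(k < n.+1) ((@meixner_norm R k)^-1)%:S).
pose sg (p : 'I_2) : R := (- 1) ^+ p.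
pose w (p : 'I_2) (k : nat) : R := sg p ^+ k * rising 2^-1 k.
pose U := \matrix_(k < n.+1, p < 2) (w p k)%:S.
have sg2 p : sg p ^+ 2 = 1 by rewrite sqrr_sign.
have D'D : D' *m D = 1%:M.
  rewrite mulmx_diag -[RHS]diag_const_mx; congr diag_mx.
  by apply/rowP => k; rewrite !mxE -rmorphM mulVf ?meixner_norm_neq0.
have TU i p : (T *m U) i p = ((sg p / 2) ^+ i)%:S.
  have := meixner_eigen _ i (sg2 p).
  rewrite (stieltjes_sum_widen _ _ _ _ (ltn_ord i : (i <= n)%N)) => <-.
  by rewrite rmorph_sum mxE; apply: eq_bigr => k _; rewrite !mxE [RHS]fps_constM.
have TDT i j : (T *m D *m T^T) i j =
    (stieltjes meixner_b (i + j) 0 / Num.sqrt 2)%:S.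
  have H0 : meixner_norm 0 = (Num.sqrt 2)^-1 :> R.
    by rewrite /meixner_norm alpha0 expr1n !mul1r.
  have := stieltjes_sum_moment meixner_b _ i j (@meixner_normS R).
  rewrite H0 (stieltjes_sum_widen _ _ _ _ (ltn_ord i : (i <= n)%N)) => <-.
  rewrite rmorph_sum mxE; apply: eq_bigr => k _.
  by rewrite mul_mx_diag !mxE -!rmorphM; congr _%:S; ring.
have -> : \matrix_(i < n.+1, j < n.+1)
     ((stieltjes (@meixner_b R) (i + j) 0 / Num.sqrt 2)%:S
      + t * (2^-1 ^+ (i + j) + (- 2^-1) ^+ (i + j))%:S) =
    T *m (D + U *m (t *: U^T)) *m T^T.
  apply/matrixP => i j; rewrite mulmxDr mulmxDl.
  rewrite mxE [RHS]mxE; apply: (congr2 +%R (esym (TDT i j))).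
  rewrite mulmxA -mulmxA -scalemxAl -trmx_mul -scalemxAr mxE; congr (_ * _).
  rewrite mxE 2!big_ord_recl big_ord0 addr0 ![(_ *m _)^T _ _]mxE !TU -!rmorphM -rmorphD.
  congr _%:S; rewrite /sg /= expr0 expr1 mul1r mulN1r.
  by rewrite !exprD.
rewrite !det_mulmx det_tr.
have -> : \det T = 1.
  rewrite det_trig; first by rewrite big1 // => i _; rewrite mxE stieltjes_diag.
  by apply/is_trig_mxP => i j ij; rewrite mxE stieltjes_gt ?rmorph0.
rewrite mulr1 mul1r (det_addM _ _ _ _ _ _ D'D) det_diag rmorph_prod.
congr (_ * _); first by apply: eq_bigr => k _; rewrite mxE.
(* The sign [sg p * sg p'] is 1 on the diagonal and -1 off it, so only the sums [S0] and [S1]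
   occur. *)
have VDU p p' : (1%:M + t *: U^T *m D' *m U) p p' =
    (p == p')%:R + t * (\sum_(k < n.+1)
      (sg p * sg p') ^+ k * (Num.sqrt 2 * alpha R k))%:S.
  rewrite mxE [1%:M _ _]mxE -!scalemxAl mxE; congr (_ + _ * _).
  rewrite rmorph_sum mxE; apply: eq_bigr => k _.
  rewrite mul_mx_diag !mxE -!rmorphM -rising_half_sqr /w exprMn; congr _%:S; ring.
have S0 : \sum_(k < n.+1) 1 ^+ k * (Num.sqrt 2 * alpha R k) =
    Num.sqrt 2 * alpha_sum R n.+1.
  by rewrite mulr_sumr; apply: eq_bigr => k _; rewrite expr1n mul1r.
have S1 : \sum_(k < n.+1) (- 1) ^+ k * (Num.sqrt 2 * alpha R k) =
    (- 1) ^+ n * (Num.sqrt 2 * ((2 * n%:R + 1) * alpha R n)).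
  rewrite mulrCA -alt_alpha_sum mulr_sumr.
  by apply: eq_bigr => k _; rewrite mulrCA.
have s0 : sg 0 = 1 by [].
have s1 : sg 1 = - 1 by rewrite /sg expr1.
rewrite det_mx22 !VDU s0 s1 /= mulrNN !mulr1 mul1r S0 S1.
set K := (Num.sqrt 2 * alpha_sum R n.+1)%:S; set K' := _ * (_ * alpha R n).
rewrite -!expr2 !add0r; congr (_ - _).
by rewrite fps_constM !exprMn -rmorphXn /= sqrr_sign mul1r.
Qed.

Lemma hankelD_eqmodq {R : realType} n :
  eqmodq 3 (hankelD R n) ((hankel_const R n.+1)%:S *
    hankel_factor (alpha_sum R n.+1) ((2 * n%:R + 1) * alpha R n)).
Proof.
pose M := \matrix_(i < n.+1, j < n.+1)
     ((stieltjes (@meixner_b R) (i + j) 0 / Num.sqrt 2)%:S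
      + (fps_q + fps_q ^+ 2) * (2^-1 ^+ (i + j) + (- 2^-1) ^+ (i + j))%:S).
pose S := diag_mx (\row_(i < n.+1) ((- 1) ^+ i./2 : R)%:S).
pose S' := diag_mx (\row_(j < n.+1) ((- 1) ^+ uphalf j : R)%:S).
have -> : (hankel_const R n.+1)%:S *
    hankel_factor (alpha_sum R n.+1) ((2 * n%:R + 1) * alpha R n) =
    \det (S *m M *m S').
  (* The two sign matrices together contribute (-1)^k, since the lower and upper halves of k add up
     to k. *)
  have cE : hankel_const R n.+1 = \prod_(k < n.+1) (- 1) ^+ k./2
      * \prod_(k < n.+1) (- 1) ^+ uphalf k * \prod_(k < n.+1) meixner_norm k.
    rewrite /hankel_const -!big_split; apply: eq_bigr => k _ /=.
    by rewrite -exprD; congr (_ ^+ _ * _); lia.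
  have SE : \det S = (\prod_(k < n.+1) (- 1) ^+ k./2)%:S.
    by rewrite det_diag rmorph_prod; apply: eq_bigr => k _; rewrite mxE.
  have S'E : \det S' = (\prod_(k < n.+1) (- 1) ^+ uphalf k)%:S.
    by rewrite det_diag rmorph_prod; apply: eq_bigr => k _; rewrite mxE.
  rewrite !det_mulmx det_meixner_perturbed -/(hankel_factor _ _) SE S'E cE.
  by rewrite !fps_constM; move: (hankel_factor _ _) => f; ring.
apply: eqmodq_det => i j; apply: eqmodq_trans.
  by rewrite mxE; exact: c_eqmodq.
rewrite mul_mx_diag [X in eqmodq _ _ X]mxE mul_diag_mx !mxE.
by rewrite [in X in eqmodq _ X _]fps_constM [X in eqmodq _ _ X]mulrAC.
Qed.

(** Since 2n alpha_n = -(2n-1) alpha_(n-1) and the sign disappears on squaring, this form also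
    covers D_(-1) = 1. *)
Lemma hankelD_pred_eqmodq {R : realType} n :
  eqmodq 3 (hankelD_pred R n) ((hankel_const R n)%:S *
    hankel_factor (alpha_sum R n) (2 * n%:R * alpha R n)).
Proof.
case: n => [|n] /=.
  rewrite /hankel_const /alpha_sum /hankel_factor !big_ord0.
  by rewrite !mulr0 mul0r !mulr0 !rmorph0 !mulr0 addr0 expr0n /= subr0 expr1n mul1r.
apply: eqmodq_trans (hankelD_eqmodq n) _.
have -> : 2 * n.+1%:R * alpha R n.+1 = - ((2 * n%:R + 1) * alpha R n).
  rewrite alphaS -[n.+1%:R]natr1; have n0 : 0 <= n%:R :> R by [].
  by field; apply/eqP; lra.
by rewrite /hankel_factor mulrN rmorphN mulrN sqrrN.
Qed.

(** * Expansion of the Jacobi coefficients to order two *)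

Lemma fps_coefM0 {K : fieldType} (f g : fps K) : (f * g) 0%N = f 0%N * g 0%N.
Proof. by rewrite fps_coefM big_ord1. Qed.

Lemma fps_coefM1 {K : fieldType} (f g : fps K) :
  (f * g) 1%N = f 0%N * g 1%N + f 1%N * g 0%N.
Proof. by rewrite fps_coefM !big_ord_recl big_ord0 addr0. Qed.

Lemma fps_coefM2 {K : fieldType} (f g : fps K) :
  (f * g) 2%N = f 0%N * g 2%N + f 1%N * g 1%N + f 2%N * g 0%N.
Proof. by rewrite fps_coefM !big_ord_recl big_ord0 addr0 addrA. Qed.

Lemma hankel_factor_coef {R : realType} (a b : R) :
  [/\ hankel_factor a b 0%N = 1,
      hankel_factor a b 1%N = 2 * Num.sqrt 2 * a &
      hankel_factor a b 2%N = 2 * Num.sqrt 2 * a + 2 * (a ^+ 2 - b ^+ 2)].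
Proof.
have s2 : Num.sqrt 2 ^+ 2 = 2 :> R by rewrite sqr_sqrtr.
have coefD (f g : fps R) m : (f + g) m = f m + g m by [].
have coefN (f : fps R) m : (- f) m = - f m by [].
pose coefE := (coefD, coefN, @fps_coefM0 R, @fps_coefM1 R, @fps_coefM2 R).
rewrite /hankel_factor !expr2; split; rewrite !coefE /=; [ring | ring |].
transitivity (2 * Num.sqrt 2 * a + Num.sqrt 2 ^+ 2 * (a ^+ 2 - b ^+ 2)).
  by ring.
by rewrite s2.
Qed.

(** Clearing denominators gives a(n)^2 F^2 = h Fm Fp modulo q^3, a triangular system solved for the
    coefficients in turn. *)
Lemma asq_coef {R : realType} n :
  [/\ asq R n 0%N = (n%:R + 1) * (n%:R + 2^-1),
      asq R n 1%N =
        - ((2 * n%:R + 1) * (4 * n%:R + 3) * alpha R n / Num.sqrt 2) &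
      asq R n 2%N =
        (2 * n%:R + 1) * (4 * n%:R + 3) * alpha R n
          * (alpha_sum R n.+1 - (Num.sqrt 2)^-1)
        + 3 * (2 * n%:R + 1) ^+ 2 * alpha R n ^+ 2].
Proof.
set A := alpha_sum R n.+1; set a := alpha R n.
set F := hankel_factor A ((2 * n%:R + 1) * a).
set Fm := hankel_factor (alpha_sum R n) (2 * n%:R * a).
set Fp := hankel_factor (alpha_sum R n.+2) ((2 * n.+1%:R + 1) * alpha R n.+1).
set h := (n%:R + 1) * (n%:R + 2^-1).
have [F0 F1 F2] := hankel_factor_coef A ((2 * n%:R + 1) * a).
have [Fm0 Fm1 Fm2] := hankel_factor_coef (alpha_sum R n) (2 * n%:R * a).
have [Fp0 Fp1 Fp2] := hankel_factor_coef (alpha_sum R n.+2)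
   ((2 * n.+1%:R + 1) * alpha R n.+1).
rewrite -/F in F0 F1 F2; rewrite -/Fm in Fm0 Fm1 Fm2; rewrite -/Fp in Fp0 Fp1 Fp2.
(* The ratio of the constants is h = b_(n+1), the Jacobi coefficient at q = 0. *)
have cst : hankel_const R n * hankel_const R n.+2 = h * hankel_const R n.+1 ^+ 2.
  rewrite /hankel_const !big_ord_recr /= meixner_normS exprS /h /meixner_b.
  by rewrite -[n.+1%:R]natr1; field.
have eqF : eqmodq 3 (asq R n * F ^+ 2) (h%:S * (Fm * Fp)).
  apply: (@eqmodq_mulIr _ _ _ _ ((hankel_const R n.+1)%:S ^+ 2)).
    by rewrite -rmorphXn fps_unitE /= expf_neq0 // hankel_const_neq0.
  have uD : hankelD R n ^+ 2 \is a GRing.unit.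
    rewrite unitrX // fps_unitE (hankelD_eqmodq n) // fps_coefCM -/F F0 mulr1.
    exact: hankel_const_neq0.
  apply: (@eqmodq_trans _ _ _ (asq R n * hankelD R n ^+ 2)).
    rewrite -mulrA; apply: eqmodqM => //; apply: eqmodq_sym.
    rewrite mulrC -exprMn !expr2.
    by apply: eqmodqM; exact: hankelD_eqmodq.
  rewrite /asq divrK //.
  apply: eqmodq_trans.
    exact: eqmodqM (hankelD_pred_eqmodq n) (hankelD_eqmodq n.+1).
  rewrite mulrACA -fps_constM cst fps_constM rmorphXn -/Fm -/Fp.
  by rewrite [X in eqmodq _ _ X]mulrAC.
have s2 : Num.sqrt 2 ^+ 2 = 2 :> R by rewrite sqr_sqrtr.
have s20 : Num.sqrt 2 != 0 :> R by rewrite gt_eqF // sqrtr_gt0.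
have Am : alpha_sum R n = A - a by rewrite /A /alpha_sum big_ord_recr addrK.
have Ap : alpha_sum R n.+2 = A + alpha R n.+1.
  by rewrite /A /alpha_sum [LHS]big_ord_recr.
move: (asq R n) eqF => x eqF; clearbody F Fm Fp.
have := eqF 0%N isT; have := eqF 1%N isT; have := eqF 2%N isT.
rewrite !fps_coefCM !expr2 !(fps_coefM0, fps_coefM1, fps_coefM2) F0 F1 F2.
rewrite Fm0 Fm1 Fm2 Fp0 Fp1 Fp2.
rewrite -/A; set x0 := x 0%N; set x1 := x 1%N; set x2 := x 2%N.
set Bm := 2 * n%:R * _; set B := _ * alpha R n; set Bp := _ * alpha R n.+1.
(* The equations become polynomial in s = sqrt 2, subject only to s^2 = 2. *)
have sV : (Num.sqrt 2)^-1 = Num.sqrt 2 / 2 :> R.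
  by apply: (mulfI s20); rewrite mulrA -expr2 s2 !divff // pnatr_eq0.
rewrite sV; move: (Num.sqrt 2) s2 => s s2 e2 e1 e0.
move: (alpha_sum R n) (alpha_sum R n.+2) Am Ap e2 e1 e0 => Am Ap AmE ApE e2 e1 e0.
have E0 : x0 = h by transitivity (x0 * (1 * 1)); [ring | rewrite e0; ring].
have E1 : x1 = h * (2 * s * (Ap + Am - 2 * A)).
  transitivity (x0 * (1 * (2 * s * A) + 2 * s * A * 1) + x1 * (1 * 1)
                - x0 * (4 * s * A)); first by ring.
  by rewrite e1 E0; ring.
have E2 : x2 = h * (2 * s * (Ap + Am - 2 * A) + 2 * (Ap ^+ 2 - Bp ^+ 2)
    + 2 * (Am ^+ 2 - Bm ^+ 2) - 4 * (A ^+ 2 - B ^+ 2) + 8 * Ap * Am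
    - 16 * A * (Ap + Am - 2 * A) - 8 * A ^+ 2).
  pose f2 := 2 * s * A + 2 * (A ^+ 2 - B ^+ 2).
  transitivity (x0 * (1 * f2 + 2 * s * A * (2 * s * A) + f2 * 1)
     + x1 * (1 * (2 * s * A) + 2 * s * A * 1) + x2 * (1 * 1)
     - x0 * (2 * f2 + 4 * s ^+ 2 * A ^+ 2) - x1 * (4 * s * A)); first by ring.
  rewrite e2 E0 E1 /f2.
  transitivity (h * (2 * s * (Ap + Am - 2 * A) + 2 * (Ap ^+ 2 - Bp ^+ 2)
    + 2 * (Am ^+ 2 - Bm ^+ 2) - 4 * (A ^+ 2 - B ^+ 2) + s ^+ 2 * (4 * Ap * Am
    - 8 * A * (Ap + Am - 2 * A) - 4 * A ^+ 2))); first by ring.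
  by rewrite s2; ring.
have n0 : 0 <= n%:R :> R by [].
rewrite E0 E1 E2 ApE AmE /Bm /B /Bp /h alphaS -[n.+1%:R]natr1 -/a.
clear -n0; clearbody A a.
by split=> //; field; apply/eqP; lra.
Qed.


Theorem theorem7p5 (R : realType) (n : nat) :
  let Y : R := hyp2F1 1 (n%:R + 2^-1) (n%:R + 1) (-1) in
  let delta1 : R :=
    - ((16 * n%:R ^+ 2 + 8 * n%:R + 3) / Num.sqrt 2 * alpha R n) in
  let delta2 : R :=
    (8 * n%:R ^+ 2 + 22 * n%:R + 6 - (16 * n%:R ^+ 2 + 8 * n%:R + 3) * Y)
    * alpha R n ^+ 2 in
  (exists r : fps R[i],
     (- 'i%C)%:S * d R n =
     (delta1%:C%C)%:S * fps_q + (delta2%:C%C)%:S * fps_q ^+ 2 + fps_q ^+ 3 * r)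
  /\ ((- 'i%C)%:S * d R n) 2%N = delta2%:C%C.
Proof.
move=> Y delta1 delta2.
(* The factor -i cancels the i in [d], so every coefficient is that of the real series [g]. *)
pose g := ((- 2 * n%:R - 2^-1)%:S + asq R n - asq_pred R n).
have dE m : ((- 'i%C)%:S * d R n) m = (g m)%:C%C.
  have ii : (- 'i%C) * 'i%C = 1 :> R[i].
    by rewrite mulNr -expr2 complex.sqr_i opprK.
  by rewrite /d mulrA -fps_constM ii fps_coefCM mul1r.
have s20 : Num.sqrt 2 != 0 :> R by rewrite gt_eqF // sqrtr_gt0.
have aY : alpha R n * Y = (Num.sqrt 2)^-1 - alpha_sum R n := alpha_hyp2F1 n.
have g012 : [/\ g 0%N = 0, g 1%N = delta1 & g 2%N = delta2].
  have [x0 x1 x2] := @asq_coef R n.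
  (* One factor alpha_n is kept next to Y, so that [aY] eliminates the hypergeometric value. *)
  have d2E : delta2 = (8 * n%:R ^+ 2 + 22 * n%:R + 6) * alpha R n ^+ 2 -
      (16 * n%:R ^+ 2 + 8 * n%:R + 3) * alpha R n * (alpha R n * Y).
    by rewrite /delta2; ring.
  have g0 : g 0%N = - 2 * n%:R - 2^-1 + asq R n 0%N - asq_pred R n 0%N by [].
  have g1 : g 1%N = 0 + asq R n 1%N - asq_pred R n 1%N by [].
  have g2 : g 2%N = 0 + asq R n 2%N - asq_pred R n 2%N by [].
  rewrite d2E aY g0 g1 g2 x0 x1 x2 /delta1 !add0r.
  clear -s20.
  (* The case n = 0 is separate because a(-1)^2 = 0 by convention. *)
  case: n => [|n].
    rewrite /alpha_sum big_ord_recr !big_ord0 /= alpha0.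
    by split; field.
  have [x0 x1 x2] := @asq_coef R n.
  have -> : alpha_sum R n.+2 = alpha_sum R n.+1 + alpha R n.+1.
    by rewrite /alpha_sum [LHS]big_ord_recr.
  rewrite [asq_pred _ _]/= x0 x1 x2 alphaS -[n.+1%:R]natr1.
  move: (alpha_sum R n.+1) (alpha R n) => A a.
  have n0 : 0 <= n%:R :> R by [].
  have n1 : 2 * n%:R + 2 != 0 :> R by apply/eqP; lra.
  by split; field; rewrite ?s20 ?n1.
have [g0 g1 g2] := g012; split; last by rewrite dE g2.
(* The remainder is [g] shifted by three places; Horner form then allows reading off coefficients
   one at a time. *)
exists (Fps (fun m => (g m.+3)%:C%C)); apply: fpsP => m; rewrite dE.
have -> : (delta1%:C%C)%:S * fps_q + (delta2%:C%C)%:S * fps_q ^+ 2 +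
    fps_q ^+ 3 * Fps (fun m => (g m.+3)%:C%C) =
  fps_q * ((delta1%:C%C)%:S + fps_q * ((delta2%:C%C)%:S +
    fps_q * Fps (fun m => (g m.+3)%:C%C))) by ring.
have consE (K : fieldType) (a : K) (f : fps K) k :
    (a%:S + fps_q * f) k.+1 = f k.
  by rewrite -[LHS]/(0 + (fps_q * f) k.+1) fps_coef_qMS add0r.
have cons0 (K : fieldType) (a : K) (f : fps K) : (a%:S + fps_q * f) 0%N = a.
  by rewrite -[LHS]/(a + (fps_q * f) 0%N) fps_coef_qM0 addr0.
case: m => [|[|[|m]]]; first by rewrite fps_coef_qM0 g0.
- by rewrite fps_coef_qMS cons0 g1.
- by rewrite fps_coef_qMS consE cons0 g2.
- by rewrite fps_coef_qMS !consE.
Qed.
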